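(* Let $\mathcal{F}:\mathbb{F}_{q^t}^r\to\mathbb{F}_q^{rt}$ be a vfr-map. Let $\pi,\pi'$ be $(n-1)$-dimensional subspaces of $\mathrm{PG}(rt-1,q)$ intersecting in a point $P=\langle\mathcal{F}(v)\rangle_q$ such that $\pi\cap\{\langle\mathcal{F}(\alpha v)\rangle_q\mid\alpha\in\mathbb{F}_{q^t}^*\}=\pi'\cap\{\langle\mathcal{F}(\alpha v)\rangle_q\mid\alpha\in\mathbb{F}_{q^t}^*\}=\{P\}$. Suppose $\mathcal{B}(\pi)=\mathcal{B}(\pi')$ and that Condition (B) holds for $(L,n)$ with $L=\mathcal{B}(\pi)$. Then $\pi=\pi'$.
   Context: A vfr-map $\mathcal{F}:\mathbb{F}_{q^t}^r\to\mathbb{F}_q^{rt}$ is an $\mathbb{F}_q$-linear bijection (e.g. obtained by fixing an $\mathbb{F}_q$-basis of $\mathbb{F}_{q^t}$ and taking coordinates). Points of $\mathrm{PG}(rt-1,q)$ are $\langle w\rangle_q$, points of $\mathrm{PG}(r-1,q^t)$ are $\langle v\rangle_{q^t}$; for a subspace $U$ of $\mathbb{F}_q^{rt}$, $\langle U\rangle_q$ is the projective subspace it determines. For an $\mathbb{F}_q$-subspace $U$, $\mathcal{B}(U)=\{\langle v\rangle_{q^t}\mid v\in\mathcal{F}^{-1}(U\setminus\{0\})\}$ and $\mathcal{B}(\langle U\rangle_q)=\mathcal{B}(U)$. For $\beta\in\mathbb{F}_{q^t}^*$, $m_\beta:v\mapsto\beta v$ on $\mathbb{F}_{q^t}^r$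 and $\mathcal{F}(m_\beta)$ is the map on $\mathbb{F}_q^{rt}$ with $\mathcal{F}(m_\beta)(\mathcal{F}(v))=\mathcal{F}(\beta v)$. Condition (B) for $(L,n)$: whenever $U,U'$ are $n$-dimensional $\mathbb{F}_q$-subspaces of $\mathbb{F}_q^{rt}$ with $\mathcal{B}(U)=L=\mathcal{B}(U')$, then $U'=\mathcal{F}(m_\beta)(U)$ for some $\beta\in\mathbb{F}_{q^t}^*$. *)

(* Defs.v *)
From mathcomp Require Import all_boot all_order all_algebra all_field.
From mathcomp Require Import classical_sets.

Set Implicit Arguments.
Unset Strict Implicit.
Unset Printing Implicit Defensive.

Import GRing.Theory.
Local Open Scope ring_scope.
Local Open Scope classical_set_scope.

(* F_q is a finite field F and F_{q^t} is an extension L of F of degree t.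
   The library puts only an L-module structure on 'rV[L]_r, so F-linearity is
   spelled out; a%:A is the image in L of a : F. *)
Record vfr_map (F : finFieldType) (L : fieldExtType F) (r t : nat) := VfrMap {
  vfr_fun :> 'rV[L]_r -> 'rV[F]_(r * t);
  vfr_inv : 'rV[F]_(r * t) -> 'rV[L]_r;
  vfr_add : forall u v, vfr_fun (u + v) = vfr_fun u + vfr_fun v;
  vfr_scale : forall (a : F) v, vfr_fun (a%:A *: v) = a *: vfr_fun v;
  vfr_funK : cancel vfr_fun vfr_inv;
  vfr_invK : cancel vfr_inv vfr_fun
}.

(* A projective subspace of PG(m-1, K) is encoded by the vector subspace U that
   determines it, of vector space dimension one more; points are the lines
   <[w]> with w != 0, and pg_points U is the set of points lying on it. *)
Definition pg_points (K : fieldType) (m : nat) (U : {vspace 'rV[K]_m}) :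
    set {vspace 'rV[K]_m} :=
  [set <[w]>%VS | w in [set w | w \in U /\ w != 0]].

Section Vfr.
Variables (F : finFieldType) (L : fieldExtType F) (r t : nat).
Variable f : vfr_map L r t.

Definition vfr_B (U : {vspace 'rV[F]_(r * t)}) : set {vspace 'rV[L]_r} :=
  [set <[v]>%VS | v in f @^-1` [set w | w \in U /\ w != 0]].

Definition vfr_mul (beta : L) (w : 'rV[F]_(r * t)) : 'rV[F]_(r * t) :=
  f (beta *: vfr_inv f w).

Lemma vfr_mulE (beta : L) (v : 'rV[L]_r) : vfr_mul beta (f v) = f (beta *: v).
Proof. by rewrite /vfr_mul vfr_funK. Qed.

Definition spread_elt (v : 'rV[L]_r) : set {vspace 'rV[F]_(r * t)} :=
  [set <[f (alpha *: v)]>%VS | alpha in [set alpha : L | alpha != 0]].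

Definition condition_B (S : set {vspace 'rV[L]_r}) (n : nat) : Prop :=
  forall U U' : {vspace 'rV[F]_(r * t)},
    \dim U = n -> \dim U' = n -> vfr_B U = S -> vfr_B U' = S ->
    exists2 beta : L, beta != 0 &
      [set w | w \in U'] = vfr_mul beta @` [set w | w \in U].

End Vfr.

(* Main.v *)
(* Condition (B) gives beta with pi' = beta pi, so pi' contains f (beta v). This
   point also lies on the spread element of v, which meets pi' only in <f v>;
   hence beta v is an F-multiple of v, beta lies in F, and beta pi = pi. *)

Require Import Defs.
From mathcomp Require Import all_boot all_order all_algebra all_field.
From mathcomp Require Import classical_sets.

Import GRing.Theory.
Local Open Scope ring_scope.
Local Open Scope classical_set_scope.

(** A point has many generators, and the one supplied by [pg_points] need not be [w]; but both span
    the same line, which lies inside [U]. *)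
Lemma pg_points_line (K : fieldType) (m : nat) (U : {vspace 'rV[K]_m})
    (w : 'rV[K]_m) : pg_points U <[w]>%VS -> w \in U.
Proof.
case=> x [xU _] eq_xw.
by apply: (subvP _ _ (memv_line w)); rewrite -eq_xw -memvE.
Qed.

Lemma vfr_fun_eq0 (F : finFieldType) (L : fieldExtType F) (r t : nat)
    (f : vfr_map L r t) (u : 'rV[L]_r) : (f u == 0) = (u == 0).
Proof.
(* Zero is rewritten as [0%:A *: 0], so that the scalar pulled out by [vfr_scale] is the zero of
   [F]. *)
have f0 : f 0 = 0 by rewrite -(scale0r 0) -(scale0r (1 : L)) vfr_scale scale0r.
by rewrite -{1}f0 (can_eq (vfr_funK f)).
Qed.

(** Hence multiplication by an element of the base field maps every [F]-subspace into itself. *)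
Lemma vfr_mul_base (F : finFieldType) (L : fieldExtType F) (r t : nat)
    (f : vfr_map L r t) (c : F) (w : 'rV[F]_(r * t)) :
  vfr_mul f c%:A w = c *: w.
Proof. by rewrite /vfr_mul vfr_scale vfr_invK. Qed.

Theorem theorem6p5 (F : finFieldType) (L : fieldExtType F) (r t n : nat)
    (dimL : \dim {:L} = t) (f : vfr_map L r t)
    (pi pi' : {vspace 'rV[F]_(r * t)})
    (dim_pi : \dim pi = n) (dim_pi' : \dim pi' = n)
    (v : 'rV[L]_r) (v_neq0 : v != 0)
    (P_on : (pg_points pi `&` pg_points pi') <[f v]>%VS)
    (P_pi : pg_points pi `&` spread_elt f v = [set <[f v]>%VS])
    (P_pi' : pg_points pi' `&` spread_elt f v = [set <[f v]>%VS])
    (eqB : vfr_B f pi = vfr_B f pi')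
    (condB : condition_B f (vfr_B f pi) n) :
  pi = pi'.
Proof.
have fv_pi : f v \in pi by case: P_on => /pg_points_line.
have [beta beta_neq0 pi'E] := condB _ _ dim_pi dim_pi' erefl (esym eqB).
have fbv_pi' : f (beta *: v) \in pi'.
  suff: [set w | w \in pi'] (f (beta *: v)) by [].
  by rewrite pi'E; exists (f v); rewrite ?vfr_mulE.
have fbv_neq0 : f (beta *: v) != 0.
  by rewrite vfr_fun_eq0 scaler_eq0 negb_or beta_neq0.
have line_eq : <[f (beta *: v)]>%VS = <[f v]>%VS.
  suff: [set <[f v]>%VS] <[f (beta *: v)]>%VS by [].
  by rewrite -P_pi'; split; [exists (f (beta *: v)) | exists beta].
have /vlineP[c fbvE] : f (beta *: v) \in <[f v]>%VS.
  by rewrite -line_eq memv_line.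
(* Injectivity of [f] turns the relation into [beta *: v = c%:A *: v], where the nonzero [v]
   cancels. *)
have betaE : beta = c%:A.
  move: fbvE; rewrite -vfr_scale => /(can_inj (vfr_funK f)) /eqP.
  by rewrite -subr_eq0 -scalerBl scaler_eq0 (negPf v_neq0) orbF subr_eq0 => /eqP.
(* As the dimensions agree, the inclusion of [pi'] in [pi] suffices. *)
apply/esym/eqP; rewrite eqEdim dim_pi dim_pi' leqnn andbT.
apply/subvP => w w_pi'.
have : [set w | w \in pi'] w by [].
by rewrite pi'E betaE => -[u u_pi <-]; rewrite vfr_mul_base memvZ.
Qed.
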